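(* Let $\boldsymbol a=\Gamma\curvearrowright^a(X,\mu)$ and $\boldsymbol b=\Gamma\curvearrowright^b(Y,\nu)$ be measure preserving actions of a countable group $\Gamma$. Assume that $\boldsymbol a$ is free. If $\boldsymbol a\prec\boldsymbol b$ then $PC(\boldsymbol b)\le PC(\boldsymbol a)$.
   Context: A measure preserving (m.p.) action $\boldsymbol a=\Gamma\curvearrowright^a(X,\mu)$ is a Borel action of the countable discrete group $\Gamma$ on a standard probability space preserving $\mu$. It is free if $\mu(\{x:\gamma^a x=x\})=0$ for every $\gamma\in\Gamma\setminus\{e\}$. $\boldsymbol a\prec\boldsymbol b$ ($\boldsymbol a$ is weakly contained in $\boldsymbol b$) means: for all Borel $A_1,\dots,A_n\subseteq X$, finite $F\subseteq\Gamma$ and $\epsilon>0$ there are Borel $B_1,\dots,B_n\subseteq Y$ with $|\mu(\gamma^aA_i\cap A_j)-\nu(\gamma^bB_i\cap B_j)|<\epsilon$ for all $\gamma\in F$, $i,j\le n$. Cost. An L-graphing on $(X,\mu)$ is a countable family $\Phi=\{\varphi_i:A_i\to B_i\}$ of $\mu$-preserving Borel bijections between Borel subsets of $X$; its cost is $C_\mu(\Phi)=\sum_i\mu(A_i)$. It is an L-graphing of a $\mu$-preserving countable Borel equivalence relation $E$ if the equivalence relation generated by $\Phi$ agrees with $E$ on a conull set. The cost of $E$ is $C_\mu(E)=\inf\{C_\mu(\Phi):\Phi\text{ an L-graphing of }E\}\in[0,\infty]$. Pseudocost. An exhaustion of $E$ is a sequence $E_0\subseteq E_1\subseteq\cdots$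 of Borel subequivalence relations of $E$ with $\bigcup_nE_n=E$. The pseudocost of $E$ is $PC_\mu(E)=\inf\{\liminf_nC_\mu(E_n):(E_n)_{n\in\mathbb N}\text{ an exhaustion of }E\}$. For an m.p. action $\boldsymbol a$ with orbit equivalence relation $E_a$, $PC(\boldsymbol a)=PC_\mu(E_a)$. *)

(* Defs.v *)
From HB Require Import structures.
From mathcomp Require Import all_boot all_order all_algebra.
From mathcomp Require Import all_classical all_reals all_analysis.

Set Implicit Arguments.
Unset Strict Implicit.
Unset Printing Implicit Defensive.

Local Open Scope classical_set_scope.

(* A measurable space isomorphic to a Polish space with its Borel sigma-algebra.
   A Hausdorff pseudometric space is a metric space. *)
Definition standard_borel (R : realType) (d : measure_display)
    (X : measurableType d) : Prop :=
  exists (P : completePseudoMetricType R) (f : X -> P),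
    [/\ hausdorff_space P,
        exists2 D : set P, countable D & dense D,
        bijective f &
        forall A : set X, measurable A <-> <<s @open P >> (f @` A)].

(* As the acting group is countable and discrete, an action is Borel iff each
   group element acts by a Borel map. *)
Record mp_action (Gamma : groupType) (R : realType) (d : measure_display)
    (X : measurableType d) (mu : probability X R) := MPAction {
  act :> Gamma -> X -> X;
  act1 : forall x, act 1%g x = x;
  actM : forall g h x, act (g * h)%g x = act g (act h x);
  measurable_act : forall g, measurable_fun [set: X] (act g);
  measure_act : forall g (A : set X), measurable A -> mu (act g @^-1` A) = mu A
}.

Definition free_action (Gamma : groupType) (R : realType) (d : measure_display)
    (X : measurableType d) (mu : probability X R) (a : mp_action Gamma mu) :
    Prop :=
  forall g : Gamma, g <> 1%g -> mu [set x | a g x = x] = 0%E.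

Definition weakly_contained (Gamma : groupType) (R : realType)
    (d1 d2 : measure_display) (X : measurableType d1) (Y : measurableType d2)
    (mu : probability X R) (nu : probability Y R)
    (a : mp_action Gamma mu) (b : mp_action Gamma nu) : Prop :=
  forall (n : nat) (A : 'I_n -> set X) (F : set Gamma) (eps : R),
    (forall i, measurable (A i)) -> finite_set F -> (0 < eps)%R ->
    exists2 B : 'I_n -> set Y,
      forall i, measurable (B i) &
      forall (g : Gamma) (i j : 'I_n), F g ->
        (`| mu (a g @` A i `&` A j) - nu (b g @` B i `&` B j) | < eps%:E)%E.

Definition equivalence_set (X : Type) (E : set (X * X)) : Prop :=
  [/\ forall x, E (x, x),
      forall x y, E (x, y) -> E (y, x) &
      forall x y z, E (x, y) -> E (y, z) -> E (x, z)].

Definition orbit_rel (Gamma : groupType) (R : realType) (d : measure_display)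
    (X : measurableType d) (mu : probability X R) (a : mp_action Gamma mu) :
    set (X * X) :=
  [set p | exists g : Gamma, a g p.1 = p.2].

(* Only the values of pmap on pdom are relevant. *)
Record partial_iso (R : realType) (d : measure_display)
    (X : measurableType d) (mu : probability X R) := PartialIso {
  pdom : set X;
  pcod : set X;
  pmap : X -> X;
  measurable_pdom : measurable pdom;
  measurable_pcod : measurable pcod;
  measurable_pmap : measurable_fun pdom pmap;
  pmap_bij : set_bij pdom pcod pmap;
  measure_pmap : forall B : set X, measurable B -> B `<=` pcod ->
    mu (pdom `&` pmap @^-1` B) = mu B
}.

(* Finite families are included: pad with the map whose domain is empty, which
   changes neither the generated relation nor the cost. *)
Definition Lgraphing (R : realType) (d : measure_display)
    (X : measurableType d) (mu : probability X R) : Type :=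
  nat -> partial_iso mu.

Definition Lcost (R : realType) (d : measure_display)
    (X : measurableType d) (mu : probability X R) (Phi : Lgraphing mu) : \bar R :=
  (\sum_(0 <= i <oo) mu (pdom (Phi i)))%E.

Definition generated_rel (R : realType) (d : measure_display)
    (X : measurableType d) (mu : probability X R) (Phi : Lgraphing mu) :
    set (X * X) :=
  smallest (@equivalence_set X)
    [set p | exists2 i, pdom (Phi i) p.1 & pmap (Phi i) p.1 = p.2].

Definition Lgraphing_of (R : realType) (d : measure_display)
    (X : measurableType d) (mu : probability X R) (E : set (X * X))
    (Phi : Lgraphing mu) : Prop :=
  exists X0 : set X,
    [/\ measurable X0, mu (~` X0) = 0%E &
        forall x y, X0 x -> X0 y -> (generated_rel Phi (x, y) <-> E (x, y))].

Definition cost (R : realType) (d : measure_display)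
    (X : measurableType d) (mu : probability X R) (E : set (X * X)) : \bar R :=
  ereal_inf [set Lcost Phi | Phi in Lgraphing_of (mu := mu) E].

Definition exhaustion (d : measure_display) (X : measurableType d)
    (E : set (X * X)) (En : nat -> set (X * X)) : Prop :=
  [/\ forall n, measurable (En n) /\ equivalence_set (En n),
      forall n, En n `<=` En n.+1 &
      \bigcup_n En n = E].

Definition pseudocost (R : realType) (d : measure_display)
    (X : measurableType d) (mu : probability X R) (E : set (X * X)) : \bar R :=
  ereal_inf [set limn_einf (fun n => cost mu (En n)) | En in exhaustion E].

Definition PC (Gamma : groupType) (R : realType) (d : measure_display)
    (X : measurableType d) (mu : probability X R) (a : mp_action Gamma mu) :
    \bar R :=
  pseudocost mu (orbit_rel a).

(* Main.v *)
Require Import Defs.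
From HB Require Import structures.
From mathcomp Require Import all_boot all_order all_algebra.
From mathcomp Require Import all_classical all_reals all_analysis.
From mathcomp Require Import zify ring lra.

Set Implicit Arguments.
Unset Strict Implicit.
Unset Printing Implicit Defensive.

Import Order.TTheory GRing.Theory Num.Theory.
Local Open Scope classical_set_scope.

(* On the free side, almost every map of an L-graphing of a subrelation of the
   orbit relation is piecewise given by elements of [Gamma], so the subrelation
   is generated, at no greater cost, by edges x -> g x for x in sets [A g].  By
   freeness, a path from x to f x spells a word whose value in [Gamma] is f.
   Hence finitely many words witness, off a set of small measure, that x and f x
   are equivalent, and this is a statement about the measures of finitely many
   intersections of translates, which weak containment carries over to [b].
   So for all finite F and eps > 0 there is a finite graphing in [b] whose cost
   is less than r and which relates y to f y (f in F) off a set of measure eps.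
   To obtain an exhaustion from such graphings, keep at each stage those edges
   of the previous graphing whose end points are not related by the new one:
   the relations then increase, and the kept edges cost as little as desired,
   because the new graphing was asked to relate y to g y for all the finitely
   many g labelling the previous one. *)

(** * Standard Borel spaces *)

Section standard_borel_separation.
Context {R : realType} {d : measure_display} {X : measurableType d}.
Hypothesis X_standard : standard_borel R X.

(** Pull back small balls about the points of a countable dense set. Distinct points of [P] have
    disjoint balls about them, and a small enough ball about a dense point near the first contains
    the first and misses the second. *)
Lemma standard_borel_separating :
  exists U : nat -> set X, (forall n, measurable (U n)) /\
    forall x y, (forall n, U n x <-> U n y) -> x = y.
Proof.
have [P [f [hP [D cD dD] bijf mE]]] := X_standard.
have /countable_injP[h injh] := cD.
pose e k : R := (k.+1%:R^-1)%R.
have e_gt0 k : (0 < e k)%R by rewrite invr_gt0.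
pose O (mk : nat * nat) : set P :=
  \bigcup_(q in [set q | D q /\ h q = mk.1]) (ball q (e mk.2))^°.
exists (fun n => f @^-1` (if unpickle n is Some mk then O mk else set0)); split.
  move=> n; apply/mE; rewrite image_preimage; last first.
    by apply/seteqP; split=> // p _; case: bijf => g fK gK; exists (g p).
  apply: sub_sigma_algebra; case: (unpickle n) => [mk|]; last exact: open0.
  by apply: bigcup_open => q _; exact: open_interior.
move=> x y xy; apply: (bij_inj bijf); apply/eqP/negPn/negP => fxy.
move: hP; rewrite ball_hausdorff => /(_ _ _ fxy)[[r r']/= /eqP rr'].
have [k /andP[_ ker]] : exists k, (0 < e k)%R && (e k * 2 < r%:num)%R.
  have [k] := near_infty_natSinv_lt (PosNum (divr_gt0 (gt0 r) (ltr0n R 2))).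
  move=> _ /(_ k (leqnn _)) /= kr; exists k; rewrite e_gt0/=.
  by rewrite -ltr_pdivlMr.
have e2 : (0 < e k / 2)%R by rewrite divr_gt0.
have [q [qx Dq]] := dD _ (ex_intro _ (f x) (nbhs_singleton (nbhs_interior (nbhsx_ballx (f x) _ e2))))
  (open_interior _).
have {}qx : ball (f x) (e k / 2)%R q by exact: interior_subset qx.
have [/= + _] := xy (pickle (h q, k)); rewrite pickleK /=; case.
  exists q => //; apply: (@filterS _ _ _ (ball (f x) (e k / 2)%R)); last exact: nbhsx_ballx.
  by move=> z xz; rewrite /= [X in ball _ X _]splitr; apply: ball_triangle xz; exact: ball_sym.
move=> q' [Dq' hq'] /interior_subset q'y.
have qq' : q' = q by apply: injh hq'; rewrite inE.
rewrite qq' in q'y.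
suff : (ball (f x) r%:num `&` ball (f y) r'%:num) (f y) by rewrite rr'.
split; last exact: ballxx.
apply: (@le_ball _ _ _ (e k / 2 + e k)%R); last exact: ball_triangle qx q'y.
apply: ltW; apply: le_lt_trans ker; rewrite mulr_natr mulr2n lerD2r.
by rewrite ler_pdivrMr// mulrDr mulr1 lerDl ltW.
Qed.

(** Two points are equal as soon as no set of the countable separating family tells them apart, so
    the equalizer is a countable intersection of measurable conditions. *)
Lemma measurable_equalizer {d' : measure_display} {T : measurableType d'}
    (D : set T) (u v : T -> X) : measurable D ->
  measurable_fun D u -> measurable_fun D v ->
  measurable (D `&` [set x | u x = v x]).
Proof.
move=> mD mu mv; have [U [mU sepU]] := standard_borel_separating.
have -> : D `&` [set x | u x = v x] =
  \bigcap_n ((D `&` u @^-1` U n) `&` (D `&` v @^-1` U n) `|`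
             (D `&` u @^-1` ~` U n) `&` (D `&` v @^-1` ~` U n)).
  apply/seteqP; split=> [x [Dx /= uv] n _|x xP].
    by have [Uux|Uux] := pselect (U n (u x)); [left|right];
       split; split; rewrite //= -?uv.
  split; first by case: (xP 0 I) => -[][].
  apply: sepU => n; case: (xP n I) => -[[_ /= +] [_ /= +]] => //=.
apply: bigcapT_measurable => n.
by apply: measurableU; apply: measurableI; (apply: mu || apply: mv) => //;
  exact: measurableC.
Qed.

Lemma measurable_graph {d' : measure_display} {T : measurableType d'}
    (u : T -> X) : measurable_fun setT u ->
  measurable [set p : T * X | u p.1 = p.2].
Proof.
move=> mu; rewrite -[X in measurable X]setTI; apply: measurable_equalizer => //.
exact: measurableT_comp.
Qed.

End standard_borel_separation.

(** * Graphings by group elements *)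

Lemma countable_enum (T : Type) (t0 : T) : countable [set: T] ->
  exists e : nat -> T, forall t, exists n, e n = t.
Proof.
move=> /countable_injP[h injh].
have /choice[e eP] n : exists t, forall t', h t' = n -> t' = t.
  have [[t <-]|nt] := pselect (exists t, h t = n).
    by exists t => t' /injh; apply; rewrite inE.
  by exists t0 => t' ht'; case: nt; exists t'.
by exists e => t; exists (h t); rewrite -(eP _ t).
Qed.

Lemma countable_words (T : Type) : countable [set: T] ->
  countable [set: seq (T * bool)].
Proof.
move=> /countable_injP[h injh]; apply/countable_injP.
exists (fun w => pickle [seq (h l.1, l.2) | l <- w]) => w w' _ _.
move=> /(pcan_inj pickleK) /inj_map; apply=> -[t c] [t' c'] [] /injh tt <-; rewrite tt ?inE //.
Qed.

Section action.
Context {Gamma : groupType} {R : realType} {d : measure_display}.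
Context {X : measurableType d} {mu : probability X R} (a : mp_action Gamma mu).

Lemma actK g : cancel (a g) (a g^-1%g).
Proof. by move=> x; rewrite -actM mulVg act1. Qed.

Lemma actVK g : cancel (a g^-1%g) (a g).
Proof. by move=> x; rewrite -actM mulgV act1. Qed.

Lemma act_image g (A : set X) : a g @` A = a g^-1%g @^-1` A.
Proof.
apply/seteqP; split=> [_ [x Ax <-]|x Ax] /=; first by rewrite actK.
by exists (a g^-1%g x) => //; rewrite actVK.
Qed.

Lemma measurable_preimage_act g (A : set X) :
  measurable A -> measurable (a g @^-1` A).
Proof. by move=> mA; rewrite -[X in measurable X]setTI; apply: measurable_act. Qed.

Lemma measurable_image_act g (A : set X) :
  measurable A -> measurable (a g @` A).
Proof. by move=> mA; rewrite act_image; exact: measurable_preimage_act. Qed.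

Lemma measure_image_act g (A : set X) : measurable A -> mu (a g @` A) = mu A.
Proof. by move=> mA; rewrite act_image measure_act. Qed.

Lemma orbit_rel_equiv : equivalence_set (orbit_rel a).
Proof.
split=> [x|x y [g /= <-]|x y z [g /= <-] [h /= <-]].
- by exists 1%g; rewrite /= act1.
- by exists g^-1%g; rewrite /= actK.
- by exists (h * g)%g; rewrite /= actM.
Qed.

Definition letter_elt (l : Gamma * bool) : Gamma :=
  if l.2 then l.1 else l.1^-1%g.

(** The first letter becomes the rightmost factor because it acts first. *)
Definition word_elt (w : seq (Gamma * bool)) : Gamma :=
  foldr (fun l g => (g * letter_elt l)%g) 1%g w.

(* In a graphing [A], the edges labelled [g] join the points [x] of [A g] to
   [g x].  The letter [(g, true)] follows such an edge forwards, [(g, false)]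
   backwards; [path_set A w] is the set of the starting points of the paths
   labelled [w], read from left to right. *)
Fixpoint path_set (A : Gamma -> set X) (w : seq (Gamma * bool)) : set X :=
  if w is l :: w' then
    [set x | A l.1 (if l.2 then x else a l.1^-1%g x)] `&`
    a (letter_elt l) @^-1` path_set A w'
  else setT.

(** By [gen_edge], [gen_equiv] and [gen_sub] this is the equivalence relation generated by the
    edges; written as a union over words, it is visibly measurable when [Gamma] is countable. *)
Definition gen (A : Gamma -> set X) : set (X * X) :=
  [set p | exists2 w, path_set A w p.1 & a (word_elt w) p.1 = p.2].

Lemma path_set_cat A u w x : path_set A (u ++ w) x <->
  path_set A u x /\ path_set A w (a (word_elt u) x).
Proof.
elim: u x => [|l u IHu] x /=; first by rewrite act1; split=> // -[].
rewrite actM; split=> [[Ax /IHu[]]|[[Ax ux] wx]] //.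
by split=> //; apply/IHu.
Qed.

Lemma word_elt_cat u w : word_elt (u ++ w) = (word_elt w * word_elt u)%g.
Proof. by elim: u => [|l u IHu] /=; rewrite ?mulg1// IHu mulgA. Qed.

Lemma gen_edge (A : Gamma -> set X) g x : A g x -> gen A (x, a g x).
Proof. by move=> Ax; exists [:: (g, true)] => //=; rewrite mul1g. Qed.

(** Paths are concatenated for transitivity; for symmetry a path is reversed letter by letter,
    flipping the boolean of each. *)
Lemma gen_equiv A : equivalence_set (gen A).
Proof.
have gen_trans x y z : gen A (x, y) -> gen A (y, z) -> gen A (x, z).
  move=> [u /= ux <-] [w /= wx <-]; exists (u ++ w).
    by apply/path_set_cat.
  by rewrite /= word_elt_cat actM.
split=> //; first by move=> x; exists [::]; rewrite //= act1.
move=> x y [w]; elim: w x => [|[g c] w IHw] x /=.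
  by move=> _; rewrite act1 => <-; exists [::]; rewrite //= act1.
move=> [Ax wx]; rewrite actM => wy; apply: (gen_trans _ _ _ (IHw _ wx wy)).
exists [:: (g, ~~ c)]; rewrite /= /letter_elt /= ?mul1g; last first.
  by case: c {Ax wx wy}; rewrite /= ?actK ?actVK.
by case: c {wx wy} Ax; rewrite /= ?actK.
Qed.

Lemma gen_sub A (E : set (X * X)) : equivalence_set E ->
  (forall g x, A g x -> E (x, a g x)) -> gen A `<=` E.
Proof.
move=> [Er Es Et] AE [x y] [w /=]; elim: w x => [|[g c] w IHw] x /=.
  by rewrite act1 => _ <-.
move=> [Ax wx]; rewrite actM => wy; apply: Et (IHw _ wx wy).
by case: c Ax {wx wy} => /= [/AE//|/AE]; rewrite actVK => /Es.
Qed.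

Lemma gen_mono (A B : Gamma -> set X) :
  (forall g, A g `<=` B g) -> gen A `<=` gen B.
Proof.
move=> AB; apply: gen_sub; first exact: gen_equiv.
by move=> g x /AB; exact: gen_edge.
Qed.

Lemma gen_orbit A : gen A `<=` orbit_rel a.
Proof. by apply: gen_sub; [exact: orbit_rel_equiv|move=> g x _; exists g]. Qed.

Lemma measurable_path_set A w : (forall g, measurable (A g)) ->
  measurable (path_set A w).
Proof.
move=> mA; elim: w => [|[g c] w IHw] //=; apply: measurableI.
  case: c => /=; first exact: mA.
  exact: (@measurable_preimage_act g^-1%g).
exact: measurable_preimage_act.
Qed.

Hypothesis Gamma_countable : countable [set: Gamma].
Hypothesis X_standard : standard_borel R X.

Lemma measurable_gen A : (forall g, measurable (A g)) -> measurable (gen A).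
Proof.
move=> mA.
have -> : gen A = \bigcup_(w in [set: seq (Gamma * bool)])
    ((path_set A w `*` setT) `&` [set p | a (word_elt w) p.1 = p.2]).
  apply/seteqP; split=> [p [w wp wE]|p [w _ [[wp _] wE]]]; first by exists w.
  by exists w.
apply: countable_bigcupT_measurable; first exact: countable_words.
move=> w; apply: measurableI.
  by apply: measurableX => //; exact: measurable_path_set.
exact: (measurable_graph X_standard (measurable_act _ _)).
Qed.

Lemma measurable_orbit_rel : measurable (orbit_rel a).
Proof.
have -> : orbit_rel a = \bigcup_(g in [set: Gamma]) [set p | a g p.1 = p.2].
  by apply/seteqP; split=> [p [g gp]|p [g _ gp]]; exists g.
apply: countable_bigcupT_measurable => // g.
exact: (measurable_graph X_standard (measurable_act _ _)).
Qed.

Lemma measurable_section (E : set (X * X)) g : measurable E ->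
  measurable [set x | E (x, a g x)].
Proof.
move=> mE; rewrite -[X in measurable X]setTI.
have mag : measurable_fun setT (fun x => (x, a g x)).
  by apply/measurable_fun_pairP; split; [exact: measurable_id|exact: measurable_act].
exact: (mag _ _ mE).
Qed.

End action.

(** * Pseudocost from finite graphings *)

Lemma sum_support (T : eqType) (V : nmodType) (S S' : seq T) (F : T -> V) :
  uniq S -> uniq S' -> {subset S <= S'} -> (forall t, t \notin S -> F t = 0%R) ->
  (\sum_(t <- S') F t = \sum_(t <- S) F t)%R.
Proof.
move=> uS uS' SS' F0.
rewrite (bigID (mem S)) /= addrC big1 => [|t tS]; last exact: F0.
rewrite add0r -big_filter.
apply: perm_big; apply: uniq_perm => //; first exact: filter_uniq.
by move=> t; rewrite mem_filter andb_idr// => /SS'.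
Qed.

Section null_sets.
Context {R : realType} {d : measure_display} {X : measurableType d}.
Context (mu : probability X R).

Lemma null_bigcup (I : Type) (F : I -> set X) : countable [set: I] ->
  (forall i, measurable (F i)) -> (forall i, mu (F i) = 0%E) ->
  mu (\bigcup_i F i) = 0%E.
Proof.
move=> cI mF F0; have [[i0]|nI] := pselect (inhabited I); last first.
  by rewrite bigcup0 ?measure0// => i; case: nI; exists.
have [e eP] := countable_enum i0 cI.
apply/negligibleP; first exact: countable_bigcupT_measurable.
apply: (@negligibleS _ _ _ _ (\bigcup_n F (e n))).
  by move=> x [i _ Fx]; have [n eni] := eP i; exists n => //; rewrite eni.
by apply: negligible_bigcup => n; apply/(negligibleP _ (mF _)); exact: F0.
Qed.

Lemma probability_setC_le (A : set X) (eps : R) : measurable A ->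
  ((1 - eps)%:E <= mu A)%E -> (mu (~` A) <= eps%:E)%E.
Proof.
move=> mA; rewrite probability_setC// -(fineK (fin_num_measure mu _ mA)).
by rewrite -EFinB !lee_fin lerBlDr addrC -lerBlDr.
Qed.

Lemma null_of_le (A : set X) :
  (forall eps : R, (0 < eps)%R -> (mu A <= eps%:E)%E) -> mu A = 0%E.
Proof.
move=> le; apply/eqP; rewrite eq_le measure_ge0 andbT.
by apply/lee_addgt0Pr => e e0; rewrite add0e le.
Qed.

End null_sets.

Section finite_graphings.
Context {Gamma : groupType} {R : realType} {d : measure_display}.
Context {X : measurableType d} {mu : probability X R} (a : mp_action Gamma mu).

Definition act_piso (g : Gamma) (A : set X) (mA : measurable A) :
  partial_iso mu.
refine (@PartialIso R d X mu A (a g @` A) (a g) mA (measurable_image_act a g mA)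
  _ _ _).
- by apply: (@measurable_funS _ _ _ _ setT) => //; exact: measurable_act.
- split; [by move=> x Ax; exists x| |by move=> y [x Ax <-]; exists x].
  by move=> x y _ _ /(can_inj (actK a g)).
- move=> B mB; rewrite act_image => BA; rewrite -(measure_act a g mB).
  congr (mu _); apply/seteqP; split=> [x []//|x Bx]; split=> //.
  by have := BA _ Bx; rewrite /= actK.
Defined.

(** The restrictions of the elements of [S] to the sets [A g] form an L-graphing of [E], padded with
    empty domains past the end of [S]. *)
Lemma cost_le_gen (S : seq Gamma) (A : Gamma -> set X) (E : set (X * X))
    (X0 : set X) :
  (forall g, measurable (A g)) -> (forall g, g \notin S -> A g = set0) ->
  measurable X0 -> mu (~` X0) = 0%E ->
  (forall x y, X0 x -> X0 y -> (gen a A (x, y) <-> E (x, y))) ->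
  (cost mu E <= \sum_(g <- S) mu (A g))%E.
Proof.
move=> mA A0 mX0 X0_conull genE.
pose D i := if (i < size S)%N then A (nth 1%g S i) else set0.
have mD i : measurable (D i) by rewrite /D; case: ifP.
pose Phi : Lgraphing mu := fun i => act_piso (nth 1%g S i) (mD i).
have -> : (\sum_(g <- S) mu (A g) = Lcost Phi)%E.
  rewrite /Lcost (nneseries_split 0 (size S))// eseries0 => [|i]; last first.
    by rewrite add0n leqNgt /= /D => /negbTE ->; rewrite measure0.
  rewrite adde0 add0n (big_nth 1%g) !big_mkord; apply: eq_bigr => i _ /=.
  by rewrite /D ltn_ord.
apply: ereal_inf_lbound; exists Phi => //; exists X0; split => // x y Xx Xy.
rewrite -genE//; split=> [|].
  apply: smallest_sub; first exact: gen_equiv.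
  move=> [u v] [i /= Du <-]; apply: gen_edge.
  by move: Du; rewrite /D; case: ifP.
apply: gen_sub (x, y).
  split=> [z|z t zt|z t s zt ts] E' [E'e subE'].
  - by case: E'e.
  - by case: (E'e) => _ + _; apply; apply: zt.
  - by case: (E'e) => _ _; apply; [apply: zt|apply: ts].
move=> g z Az E' [_]; apply; rewrite /=.
have gS : g \in S by apply/negPn/negP => /A0 A0g; rewrite A0g in Az.
by exists (index g S); rewrite ?nth_index// /D index_mem gS nth_index.
Qed.

(** The bound is an extended real so that [+oo] can stand for no bound on the cost. *)
Definition finite_graphing (mu : probability X R) (r : \bar R) (SA : seq Gamma * (Gamma -> set X)) :=
  [/\ uniq SA.1, forall g, measurable (SA.2 g),
      forall g, g \notin SA.1 -> SA.2 g = set0 &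
      (\sum_(g <- SA.1) mu (SA.2 g) <= r)%E].

(** The pivot of the proof: weak containment yields this property for [b], and the property bounds
    the pseudocost. *)
Definition approx_cost_le (r : R) := forall (F : seq Gamma) (eps : R),
  (0 < eps)%R -> exists2 SA, finite_graphing mu r%:E SA &
    forall f, f \in F -> ((1 - eps)%:E <= mu [set x | gen a SA.2 (x, a f x)])%E.

End finite_graphings.

Section pseudocost_upper_bound.
Context {Gamma : groupType} {R : realType} {d : measure_display}.
Context {X : measurableType d} {mu : probability X R} (a : mp_action Gamma mu).
Hypothesis Gamma_countable : countable [set: Gamma].
Hypothesis X_standard : standard_borel R X.

Lemma finite_graphing_extend (r delta : R) (F : seq Gamma) (eps : R)
    (SA' : seq Gamma * (Gamma -> set X)) :
  approx_cost_le a r -> (0 < delta)%R -> (0 < eps)%R ->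
  finite_graphing mu +oo SA' ->
  exists SA, [/\ finite_graphing mu (r + delta)%:E SA,
    gen a SA'.2 `<=` gen a SA.2 &
    forall f, f \in F -> ((1 - eps)%:E <= mu [set x | gen a SA.2 (x, a f x)])%E].
Proof.
case: SA' => S' A' approx delta0 eps0 [/= uS' mA' A'0 _].
(* The extra cost [delta] is shared among the labels in [S']; the successor keeps the divisor
   nonzero when [S'] is empty. *)
pose e := Num.min eps (delta / (size S').+1%:R)%R.
have e0 : (0 < e)%R by rewrite lt_min eps0 divr_gt0.
have [[S A] [/= uS mA A0 SAr] FA] := approx (S' ++ F) e e0.
have mG g : measurable [set x | gen a A (x, a g x)].
  by apply: measurable_section; exact: measurable_gen.
pose A1 g := A' g `\` [set x | gen a A (x, a g x)].
have mA1 g : measurable (A1 g) by apply: measurableD.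
have A10 g : g \notin S' -> A1 g = set0 by move=> /A'0; rewrite /A1 => ->; rewrite set0D.
have AA1 : gen a A `<=` gen a (fun g => A g `|` A1 g).
  by apply: gen_mono => g x; left.
exists (undup (S ++ S'), fun g => A g `|` A1 g); split=> /=.
- split=> /= [|g|g|]; first exact: undup_uniq.
  + exact: measurableU.
  + by rewrite mem_undup mem_cat negb_or => /andP[/A0 -> /A10 ->]; rewrite setU0.
  + apply: (@le_trans _ _ (\sum_(g <- undup (S ++ S')) (mu (A g) + mu (A1 g)))%E).
      by apply: lee_sum => g _; exact: measureU2.
    rewrite big_split /= EFinD; apply: leeD.
      rewrite (@sum_support _ _ S) ?undup_uniq//.
        by move=> g gS; rewrite mem_undup mem_cat gS.
      by move=> g /A0 ->; rewrite measure0.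
    rewrite (@sum_support _ _ S') ?undup_uniq//; last 2 first.
      by move=> g gS; rewrite mem_undup mem_cat gS orbT.
      by move=> g /A10 ->; rewrite measure0.
    apply: (@le_trans _ _ (\sum_(g <- S') e%:E)%E).
      rewrite big_seq [leRHS]big_seq; apply: lee_sum => g gS'.
      apply: (@le_trans _ _ (mu (~` [set x | gen a A (x, a g x)]))).
        by apply: le_measure; rewrite ?inE//; [exact: measurableC|move=> x []].
      by apply: probability_setC_le => //; apply: FA; rewrite mem_cat gS'.
    rewrite sumEFin lee_fin big_const_seq iter_addr_0 count_predT.
    rewrite -mulr_natl; apply: (@le_trans _ _ ((size S').+1%:R * e)%R).
      by rewrite ler_pM2r// ler_nat.
    by rewrite mulrC -ler_pdivlMr// ge_min lexx orbT.
- apply: gen_sub; first exact: gen_equiv.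
  move=> g x A'x; have [gx|ngx] := pselect (gen a A (x, a g x)); first exact: AA1.
  by apply: gen_edge; right; split.
- move=> f fF; apply: (@le_trans _ _ (mu [set x | gen a A (x, a f x)])).
    apply: le_trans (FA f _); last by rewrite mem_cat fF orbT.
    by rewrite lee_fin lerD2l lerN2 ge_min lexx.
  apply: le_measure; rewrite ?inE//; last by move=> x; exact: AA1.
  apply: measurable_section; apply: measurable_gen => // g.
  exact: measurableU.
Qed.

(** Iterating the extension gives increasing relations of cost at most [r + delta] that exhaust the
    orbit relation off an invariant null set [N]. Adding the whole orbit relation on [N] to each of
    them leaves this cost bound intact. *)
Lemma PC_le_of_approx (r : R) : approx_cost_le a r -> (PC a <= r%:E)%E.
Proof.
move=> approx; apply/lee_addgt0Pr => delta delta0; rewrite -EFinD.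
have [e eP] := countable_enum 1%g Gamma_countable.
pose graphing := {SA : seq Gamma * (Gamma -> set X) | finite_graphing mu +oo SA}.
have /choice[step stepP] (p : nat * graphing) : exists SA : graphing,
    [/\ finite_graphing mu (r + delta)%:E (sval SA),
      gen a (sval p.2).2 `<=` gen a (sval SA).2 &
      forall i, (i <= p.1)%N ->
        ((1 - p.1.+1%:R^-1)%:E <= mu [set x | gen a (sval SA).2 (x, a (e i) x)])%E].
  have n0 : (0 < p.1.+1%:R^-1 :> R)%R by rewrite invr_gt0.
  have [SA [SAr sub FA]] := finite_graphing_extend
    [seq e i | i <- iota 0 p.1.+1] approx delta0 n0 (svalP p.2).
  have SAoo : finite_graphing mu +oo SA.
    by case: SAr => uS mA A0 _; split=> //; exact: leey.
  exists (exist _ SA SAoo); split=> // i ip; apply: FA.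
  by apply/mapP; exists i => //; rewrite mem_iota.
have st0 : finite_graphing mu +oo ([::], fun _ : Gamma => set0).
  by split=> //=; rewrite big_nil leey.
pose fix st n : graphing :=
  if n is n'.+1 then step (n', st n') else exist _ _ st0.
(* The shift skips the initial empty graphing, about which [stepP] gives no estimate. *)
pose E n := gen a (sval (st n.+1)).2.
have E_equiv n : equivalence_set (E n) by exact: gen_equiv.
have mE n : measurable (E n).
  by apply: measurable_gen => //; case: (svalP (st n.+1)).
have E_sub n : E n `<=` E n.+1 by case: (stepP (n.+1, st n.+1)).
have E_mono n m : (n <= m)%N -> E n `<=` E m.
  move=> /subnK <-; elim: (m - n)%N => [//|k IHk].
  by apply: subset_trans IHk _; exact: E_sub.
have E_orbit n : E n `<=` orbit_rel a by exact: gen_orbit.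
pose N0 g := \bigcap_n ~` [set x | E n (x, a g x)].
have mN0 g : measurable (N0 g).
  by apply: bigcapT_measurable => n; apply: measurableC; exact: measurable_section.
have N0_null g : mu (N0 g) = 0%E.
  apply: null_of_le => eps eps0; have [i <-] := eP g.
  (* Stage [maxn k i] is late enough both for an error below [eps] and for [e i] to be among the
     elements treated. *)
  have [k _ /(_ (maxn k i)) /= kP] := near_infty_natSinv_lt (PosNum eps0).
  have {}kP := kP (leq_maxl _ _); set n := maxn k i in kP.
  have [_ _ /(_ i (leq_maxr _ _)) En] := stepP (n, st n).
  apply: (@le_trans _ _ (mu (~` [set x | E n (x, a (e i) x)]))).
    apply: le_measure; rewrite ?inE//; last by move=> x; apply.
    by apply: measurableC; exact: measurable_section.
  apply: (@le_trans _ _ (n.+1%:R^-1)%:E); last by rewrite lee_fin ltW.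
  by apply: probability_setC_le => //; exact: measurable_section.
pose N := \bigcup_g N0 g.
have mN : measurable N by exact: countable_bigcupT_measurable.
have N_null : mu N = 0%E by exact: null_bigcup.
have notN x g : ~ N x -> exists n, E n (x, a g x).
  move=> Nx; apply: contrapT => nE; apply: Nx; exists g => // n _ /= Exg.
  by apply: nE; exists n.
(* If [a g x] were outside [N], then [x] and every [a h x] would be related to it at some stage,
   hence to each other at the later of the two stages. *)
have N_inv x g : N x -> N (a g x).
  move=> Nx; apply: contrapT => Ngx; move: Nx => [h _ Nhx].
  have [n En] := notN _ g^-1%g Ngx; have [m Em] := notN _ (h * g^-1)%g Ngx.
  rewrite actK in En; rewrite actM actK in Em.
  have [_ Es Et] := E_equiv (maxn n m).
  apply: (Nhx (maxn n m) I) => /=; apply: Et (E_mono _ _ (leq_maxr _ _) _ Em).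
  by apply: Es; exact: E_mono (leq_maxl _ _) _ En.
have [Or Os Ot] := orbit_rel_equiv a.
pose E' n := E n `|` orbit_rel a `&` (N `*` setT).
have E'_exh : exhaustion (orbit_rel a) E'.
  split=> [n|n|].
  - split.
      apply: measurableU => //; apply: measurableI; first exact: measurable_orbit_rel.
      exact: measurableX.
    have [Er Es Et] := E_equiv n.
    split=> [x|x y [/Es|[/= Oxy [Nx _]]]|x y z]; first by left.
    + by left.
    + by right; split; [exact: Os|case: Oxy => g /= <-; split=> //; exact: N_inv].
    + move=> [Exy [Eyz|[Oyz [/= Ny _]]]|[Oxy [/= Nx _]] E'yz].
      * by left; exact: Et Exy Eyz.
      * right; split; first by apply: Ot Oyz; exact: E_orbit Exy.
        have [g /= gy] := Os _ _ (E_orbit _ _ Exy).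
        by split=> //=; rewrite -gy; exact: N_inv.
      * right; split=> //; apply: Ot Oxy _.
        by case: E'yz => [/E_orbit|[]].
  - by move=> p [/E_sub|]; [left|right].
  - apply/seteqP; split=> [p [n _ [/E_orbit|[]]]//|[x y] [g /= <-]].
    have [Nx|/(notN _ g)[n En]] := pselect (N x); last by exists n => //; left.
    by exists 0%N => //; right; split; [exists g|].
apply: (@le_trans _ _ (limn_einf (fun n => cost mu (E' n)))).
  by apply: ereal_inf_lbound; exists E'.
rewrite limn_einf_lim; apply: lime_le; first exact: is_cvg_einfs.
apply: nearW => n; apply: (@le_trans _ _ (cost mu (E' n))).
  by apply: ereal_inf_lbound; exists n => /=.
have [[_ mA A0 Ar] _ _] := stepP (n, st n).
apply: le_trans Ar; apply: (@cost_le_gen _ _ _ _ _ a _ _ _ (~` N)) => //.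
- exact: measurableC.
- by rewrite setCK.
- by move=> x y Nx _; split; [left|case=> // -[_ []]].
Qed.

End pseudocost_upper_bound.

(** * Transfer by weak containment *)

Section real_valued_probability.
Context {R : realType} {d : measure_display} {X : measurableType d}.
Context (mu : probability X R).
Local Notation P A := (fine (mu A)).
Local Open Scope ring_scope.

Lemma fineK_probability (A : set X) : measurable A -> (P A)%:E = mu A.
Proof. by move=> mA; rewrite fineK// fin_num_measure. Qed.

Lemma fine_probability_mono (A B : set X) :
  measurable A -> measurable B -> A `<=` B -> P A <= P B.
Proof.
move=> mA mB AB; rewrite -lee_fin !fineK_probability//.
by apply: le_measure; rewrite ?inE.
Qed.

Lemma fine_probabilityDI (A B : set X) : measurable A -> measurable B ->
  P A = P (A `\` B) + P (A `&` B).
Proof.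
move=> mA mB; have mI := measurableI _ _ mA mB; have mD := measurableD mA mB.
apply: EFin_inj; rewrite EFinD !fineK_probability//.
by rewrite [LHS](measureDI mu mA mB).
Qed.

Lemma fine_probabilityUI (A B : set X) : measurable A -> measurable B ->
  P (A `|` B) + P (A `&` B) = P A + P B.
Proof.
move=> mA mB; rewrite (fine_probabilityDI (measurableU _ _ mA mB) mB).
rewrite setDUl setDv setU0 (setIC _ B) setKU (fine_probabilityDI mA mB); ring.
Qed.

Lemma fine_probability_bigsetU_le (G : nat -> set X) (C : set X) (eta : R) m :
  measurable C -> (forall j, measurable (G j)) ->
  (forall j, (j < m)%N -> P (G j `&` C) <= eta) ->
  P (\big[setU/set0]_(j < m) G j `&` C) <= m%:R * eta.
Proof.
move=> mC mG; elim: m => [|m IHm] GC.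
  by rewrite big_ord0 set0I measure0 mul0r.
have mU : measurable (\big[setU/set0]_(j < m) G j) by exact: bigsetU_measurable.
rewrite big_ord_recr /= setIUl -natr1 mulrDl mul1r.
apply: (@le_trans _ _ (P (\big[setU/set0]_(j < m) G j `&` C) + P (G m `&` C))).
  rewrite -fine_probabilityUI; [|exact: measurableI..].
  by rewrite lerDl fine_ge0.
by apply: lerD; [apply: IHm => j jm; apply: GC; exact: ltnW|exact: GC].
Qed.

Lemma fine_probability_bigsetU_le_sum (G : nat -> set X) m :
  (forall j, measurable (G j)) ->
  P (\big[setU/set0]_(j < m) G j) <= \sum_(j < m) P (G j).
Proof.
move=> mG; elim: m => [|m IHm]; first by rewrite !big_ord0 measure0.
have mU : measurable (\big[setU/set0]_(j < m) G j) by exact: bigsetU_measurable.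
rewrite !big_ord_recr /=; apply: le_trans (lerD IHm (lexx _)).
by rewrite -fine_probabilityUI// lerDl fine_ge0.
Qed.

(** Inclusion-exclusion up to pairs. The factor [m ^ 2] is a crude count of the pairs, and
    [m ^ 2 + m <= m.+1 ^ 2] carries the induction. *)
Lemma bonferroni (G : nat -> set X) (eta : R) m : 0 <= eta ->
  (forall j, measurable (G j)) ->
  (forall j k, (j < k < m)%N -> P (G j `&` G k) <= eta) ->
  \sum_(j < m) P (G j) - (m ^ 2)%:R * eta <= P (\big[setU/set0]_(j < m) G j).
Proof.
move=> eta0 mG; elim: m => [|m IHm] GG.
  by rewrite !big_ord0 measure0 mul0r subr0.
have mU : measurable (\big[setU/set0]_(j < m) G j) by exact: bigsetU_measurable.
have lt1 j k : (j < k < m)%N -> (j < k < m.+1)%N by move=> /andP[-> /ltnW].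
have {}IHm := IHm (fun j k jkm => GG j k (lt1 _ _ jkm)).
have lt2 j : (j < m)%N -> (j < m < m.+1)%N by move=> ->; rewrite ltnSn.
have GC := fine_probability_bigsetU_le (mG m) mG (fun j jm => GG j m (lt2 _ jm)).
have UI := fine_probabilityUI mU (mG m).
rewrite !big_ord_recr /=.
have : (m ^ 2)%:R * eta + m%:R * eta <= (m.+1 ^ 2)%:R * eta.
  rewrite -mulrDl ler_wpM2r// -natrD ler_nat.
  by rewrite !expnS !expn0; nia.
lra.
Qed.

End real_valued_probability.

Section transfer.
Context {Gamma : groupType} {R : realType} {d1 d2 : measure_display}.
Context {X : measurableType d1} {Y : measurableType d2}.
Context {mu : probability X R} {nu : probability Y R}.
Context (a : mp_action Gamma mu) (b : mp_action Gamma nu).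
Local Open Scope ring_scope.

Lemma weakly_contained_seq (T : eqType) (A : T -> set X) (L : seq T)
    (F : seq Gamma) (eta : R) : weakly_contained a b -> 0 < eta ->
  (forall t, measurable (A t)) ->
  exists2 B : T -> set Y, forall t, measurable (B t) &
    forall g s t, g \in F -> s \in L -> t \in L ->
      `|fine (mu (a g @` A s `&` A t)) - fine (nu (b g @` B s `&` B t))| < eta.
Proof.
move=> ab eta0 mA.
have [B mB BP] := ab (size L) (fun i => A (tnth (in_tuple L) i)) [set` F] eta
  (fun i => mA _) (finite_seq F) eta0.
(* For [t] outside [L] the index equals [size L], [insub] fails, and the default [set0] is taken. *)
exists (fun t => oapp B set0 (insub (index t L))).
  by move=> t; case: insub => [i|] /=.
move=> g s t Fg sL tL; have := sL; have := tL; rewrite -!index_mem => it is_.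
rewrite !insubT /=.
have := BP g (Ordinal is_) (Ordinal it) Fg.
rewrite !(tnth_nth s) /= !nth_index// -lte_fin => /le_lt_trans; apply.
rewrite -[X in (X - _)%E]fineK_probability; last first.
  by apply: measurableI => //; exact: measurable_image_act.
rewrite -[X in (_ - X)%E]fineK_probability; last first.
  by apply: measurableI => //; exact: measurable_image_act.
by rewrite -EFinB.
Qed.

(** A pair [(k, g)] stands for the test that [k x] lies in [A g]; together they say that [w] can be
    followed from [h x]. A backward letter tests the point where its step ends. *)
Fixpoint path_positions (h : Gamma) (w : seq (Gamma * bool)) :
    seq (Gamma * Gamma) :=
  if w is l :: w' then
    ((if l.2 then h else l.1^-1 * h)%g, l.1)
      :: path_positions (letter_elt l * h)%g w'
  else [::].

Lemma size_path_positions h w : size (path_positions h w) = size w.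
Proof. by elim: w h => //= l w IHw h; rewrite IHw. Qed.

Lemma path_positions_letter h w p : p \in path_positions h w ->
  exists2 l, l \in w & p.2 = l.1.
Proof.
elim: w h => //= l w IHw h; rewrite inE => /predU1P[->|/IHw[l' l'w ->]].
  by exists l => //; rewrite mem_head.
by exists l' => //; rewrite inE l'w orbT.
Qed.

Definition all_in {d : measure_display} {Z : measurableType d}
    {la : probability Z R} (c : mp_action Gamma la) (A : Gamma -> set Z)
    (s : seq (Gamma * Gamma)) : set Z :=
  foldr (fun p C => c p.1 @^-1` A p.2 `&` C) setT s.

Lemma path_setE {d : measure_display} {Z : measurableType d}
    {la : probability Z R} (c : mp_action Gamma la) (A : Gamma -> set Z) h w :
  c h @^-1` path_set c A w = all_in c A (path_positions h w).
Proof.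
elim: w h => [|[g e] w IHw] h //=; rewrite -IHw.
by apply/seteqP; split=> x [] /=; case: e; rewrite ?actM.
Qed.

Lemma all_in_sub {d : measure_display} {Z : measurableType d}
    {la : probability Z R} (c : mp_action Gamma la) (A : Gamma -> set Z) s p :
  p \in s -> all_in c A s `<=` c p.1 @^-1` A p.2.
Proof.
elim: s => //= q s IHs; rewrite inE => /predU1P[->|/IHs sub] z [] //.
by move=> _; exact: sub.
Qed.

Lemma measurable_all_in {d : measure_display} {Z : measurableType d}
    {la : probability Z R} (c : mp_action Gamma la) (A : Gamma -> set Z) s :
  (forall g, measurable (A g)) -> measurable (all_in c A s).
Proof.
move=> mA; elim: s => //= p s IHs.
by apply: measurableI => //; exact: measurable_preimage_act.
Qed.

(** Each test discards at most [eta] from [D]. *)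
Lemma probability_all_in_ge (B : Gamma -> set Y) (D : set Y) (eta : R) s :
  (forall g, measurable (B g)) -> measurable D ->
  (forall p, p \in s -> fine (nu (D `\` b p.1 @^-1` B p.2)) <= eta) ->
  fine (nu D) - (size s)%:R * eta <= fine (nu (D `&` all_in b B s)).
Proof.
move=> mB mD; elim: s => [|p s IHs] /= sB.
  by rewrite setIT mul0r subr0.
have mpB : measurable (b p.1 @^-1` B p.2) by exact: measurable_preimage_act.
have mBs := measurable_all_in b s mB.
have {}IHs := IHs (fun q qs => sB q (mem_behead (s := p :: s) qs)).
have pB := sB p (mem_head _ _).
rewrite -natr1 mulrDl mul1r.
have DI := fine_probabilityDI nu (measurableI _ _ mD mBs) mpB.
have := fine_probability_mono nu _ _ (_ : (D `&` all_in b B s) `\`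
  b p.1 @^-1` B p.2 `<=` D `\` b p.1 @^-1` B p.2).
move=> /(_ (measurableD (measurableI _ _ mD mBs) mpB) (measurableD mD mpB)).
move=> /(_ (@setSD _ _ _ _ (@subIsetl _ _ _))).
rewrite setICA (setIC (b _ @^-1` _)); lra.
Qed.

(* All of [D] passes the [size w] membership tests of [w]; its analogue [D']
   fails each of them on a set of measure at most [2 * eta]. *)
Lemma path_set_transfer (A : Gamma -> set X) (B : Gamma -> set Y)
    (D : set X) (D' : set Y) w (eta : R) :
  (forall g, measurable (A g)) -> (forall g, measurable (B g)) ->
  measurable D -> measurable D' -> D `<=` path_set a A w ->
  `|fine (mu D) - fine (nu D')| < eta ->
  (forall p, p \in path_positions 1%g w ->
    `|fine (mu (a p.1 @` D `&` A p.2)) - fine (nu (b p.1 @` D' `&` B p.2))|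
      < eta) ->
  fine (mu D) - (1 + 2 * (size w)%:R) * eta <=
    fine (nu (D' `&` path_set b B w)).
Proof.
move=> mA mB mD mD' Dw DD' AB.
have act1E (Z : Type) (f : Z -> Z) (C : set Z) : (forall z, f z = z) -> f @^-1` C = C.
  by move=> fE; apply/seteqP; split=> z /=; rewrite fE.
have pathE (B' : Gamma -> set Y) : path_set b B' w = all_in b B' (path_positions 1%g w).
  by rewrite -path_setE act1E//; exact: act1.
rewrite -(act1E _ _ (path_set a A w) (act1 a)) path_setE in Dw.
rewrite pathE.
have := @probability_all_in_ge B D' (2 * eta) (path_positions 1%g w) mB mD'.
rewrite size_path_positions => ge.
have {}ge : fine (nu D') - (size w)%:R * (2 * eta) <=
    fine (nu (D' `&` all_in b B (path_positions 1%g w))).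
  apply: ge => p pw; have := AB p pw.
  have -> : a p.1 @` D `&` A p.2 = a p.1 @` D.
    apply/setIidl => _ [x Dx <-]; exact: (all_in_sub pw (Dw _ Dx)).
  rewrite measure_image_act//.
  have mBp : measurable (b p.1 @^-1` B p.2) by exact: measurable_preimage_act.
  have -> : nu (b p.1 @` D' `&` B p.2) = nu (D' `&` b p.1 @^-1` B p.2).
    rewrite -(measure_image_act b p.1 (measurableI _ _ mD' mBp)).
    congr (nu _); rewrite !act_image; apply/seteqP; split=> y [/= D'y].
      by rewrite actVK.
    by rewrite actVK.
  have := fine_probabilityDI nu mD' mBp.
  move: DD'; rewrite !ltr_norml => /andP[? ?] ? /andP[? ?]; lra.
move: DD'; rewrite ltr_norml => /andP[? ?]; lra.
Qed.

End transfer.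

Section graphing_transfer.
Context {Gamma : groupType} {R : realType} {d1 d2 : measure_display}.
Context {X : measurableType d1} {Y : measurableType d2}.
Context {mu : probability X R} {nu : probability Y R}.
Context (a : mp_action Gamma mu) (b : mp_action Gamma nu).
Hypothesis Gamma_countable : countable [set: Gamma].
Hypothesis Y_standard : standard_borel R Y.
Local Open Scope ring_scope.

(** The path sets of the words with value [f] are made disjoint, giving pieces [D f j], and these
    are transferred along with the sets [A g]. In [b], most of the copy of [D f j] can still follow
    its word, and the copies overlap little, so by Bonferroni their union is nearly as large as the
    original one. *)
Lemma finite_graphing_transfer (S F : seq Gamma) (W : seq (seq (Gamma * bool)))
    (A : Gamma -> set X) (c r eps : R) :
  weakly_contained a b -> uniq S -> (forall g, measurable (A g)) ->
  (forall w, w \in W -> {subset [seq l.1 | l <- w] <= S}) ->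
  (\sum_(g <- S) mu (A g) <= c%:E)%E -> c < r -> 0 < eps ->
  (forall f, f \in F -> ((1 - eps)%:E <=
    mu (\big[setU/set0]_(w <- W | word_elt w == f) path_set a A w))%E) ->
  exists2 SB, finite_graphing nu r%:E SB &
    forall f, f \in F ->
      ((1 - 2 * eps)%:E <= nu [set y | gen b SB.2 (y, b f y)])%E.
Proof.
move=> ab uS mA WS Ac cr eps0 Acover.
pose m := size W; pose wrd j := nth [::] W j.
pose V f j := if word_elt (wrd j) == f then path_set a A (wrd j) else set0.
have mV f j : measurable (V f j).
  by rewrite /V; case: ifP => // _; exact: measurable_path_set.
pose D f := seqDU (V f).
have mD f j : measurable (D f j) by exact: seqDU_measurable.
pose fam (t : Gamma + Gamma * nat) :=
  match t with inl g => A g | inr (f, j) => D f j end.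
have mfam t : measurable (fam t) by case: t => [g|[f j]] /=.
pose L := [seq inl g | g <- S] ++ [seq inr (f, j) | f <- F, j <- iota 0 m].
have inlL g : (inl g \in L) = (g \in S).
  rewrite mem_cat mem_map; last by move=> ? ? [].
  by case: (g \in S) => //=; apply/negbTE/negP => /allpairsP[[f j] []].
have inrL f j : f \in F -> (j < m)%N -> inr (f, j) \in L.
  move=> fF jm; rewrite mem_cat; apply/orP; right; apply/allpairsP.
  by exists (f, j); rewrite mem_iota.
(* The identity compares measures and overlaps; the other elements compare the membership tests
   along the words. *)
pose elts := 1%g :: flatten [seq [seq p.1 | p <- path_positions 1%g w] | w <- W].
pose M := \max_(w <- W) size w.
(* The errors in units of [eta]: [size S] for the cost, [1 + 2 * M] for each of the [m] pieces,
   [m ^ 2] for the overlaps; the [1] makes [K] positive. *)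
pose K : R := (1 + size S + m * (1 + 2 * M) + m ^ 2)%:R.
have K0 : 0 < K by rewrite ltr0n.
pose eta := Num.min eps (r - c) / K.
have eta0 : 0 < eta by rewrite divr_gt0// lt_min eps0 subr_gt0.
have etaK : eta * K = Num.min eps (r - c) by rewrite mulfVK// lt0r_neq0.
have K_le k : (k <= 1 + size S + m * (1 + 2 * M) + m ^ 2)%N ->
    k%:R * eta <= eps /\ k%:R * eta <= r - c.
  move=> kK; apply/andP; rewrite -le_min -etaK mulrC ler_pM2l//.
  by rewrite ler_nat.
have [B mB BP] := weakly_contained_seq L elts ab eta0 mfam.
have elts1 : 1%g \in elts by exact: mem_head.
have act1E (d : measure_display) (Z : measurableType d) (la : probability Z R)
    (e : mp_action Gamma la) (C : set Z) : e 1%g @` C = C.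
  by rewrite act_image invg1; apply/seteqP; split=> z /=; rewrite act1.
pose B0 g := if g \in S then B (inl g) else set0.
have mB0 g : measurable (B0 g) by rewrite /B0; case: ifP.
exists (S, B0).
  split=> //= [g|]; first by rewrite /B0 => /negbTE ->.
  apply: (@le_trans _ _ (\sum_(g <- S) (mu (A g) + eta%:E))%E).
    rewrite big_seq [leRHS]big_seq; apply: lee_sum => g gS.
    have := BP 1%g (inl g) (inl g) elts1; rewrite inlL => /(_ gS gS).
    rewrite !act1E !setIid /B0 gS -(fineK_probability mu (mA g)).
    rewrite -(fineK_probability nu (mB (inl g))) -EFinD lee_fin /=.
    by rewrite ltr_norml => /andP[? ?]; lra.
  rewrite big_split /=; apply: (@le_trans _ _ (c%:E + ((size S)%:R * eta)%:E)%E).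
    apply: leeD => //; rewrite sumEFin big_const_seq iter_addr_0 count_predT.
    by rewrite mulr_natl.
  rewrite -EFinD lee_fin; have [_] := K_le (size S) ltac:(lia); lra.
move=> f fF.
pose G j := if word_elt (wrd j) == f
  then B (inr (f, j)) `&` path_set b B0 (wrd j) else set0.
have mG j : measurable (G j).
  rewrite /G; case: ifP => // _.
  by apply: measurableI => //; exact: measurable_path_set.
have G_large j : (j < m)%N ->
    fine (mu (D f j)) - (1 + 2 * M)%:R * eta <= fine (nu (G j)).
  move=> jm; rewrite /G; case: eqP => wf; last first.
    have -> : D f j = set0.
      by rewrite -subset0 => x /(@subset_seqDU _ (V f)); rewrite /V; case: eqP.
    by rewrite !measure0 /= sub0r oppr_le0 mulr_ge0// ltW.
  have wW : wrd j \in W by exact: mem_nth.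
  have sM : (size (wrd j))%:R <= M%:R :> R.
    by rewrite ler_nat; exact: (@leq_bigmax_seq _ _ xpredT).
  apply: (@le_trans _ _ (fine (mu (D f j)) - (1 + 2 * (size (wrd j))%:R) * eta)).
    by rewrite lerD2l lerN2 ler_wpM2r ?(ltW eta0)// natrD natrM; lra.
  apply: (path_set_transfer (a := a) (b := b) mA mB0 (mD f j) (mB (inr (f, j)))).
  - by move=> x /(@subset_seqDU _ (V f)); rewrite /V wf eqxx.
  - have := BP 1%g (inr (f, j)) (inr (f, j)) elts1 (inrL _ _ fF jm) (inrL _ _ fF jm).
    by rewrite !act1E !setIid.
  - move=> p pw; have [l lw pl] := path_positions_letter pw.
    have pS : p.2 \in S by rewrite pl; apply: (WS _ wW); exact: map_f.
    rewrite /B0 pS; apply: (BP p.1 (inr (f, j)) (inl p.2)).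
    + rewrite inE; apply/orP; right; apply/flattenP.
      exists [seq p.1 | p <- path_positions 1%g (wrd j)]; last exact: map_f.
      exact: map_f.
    + exact: inrL.
    + by rewrite inlL.
have G_disj j k : (j < k < m)%N -> fine (nu (G j `&` G k)) <= eta.
  move=> /andP[jk km]; have jm := ltn_trans jk km.
  have := BP 1%g (inr (f, j)) (inr (f, k)) elts1 (inrL _ _ fF jm) (inrL _ _ fF km).
  rewrite !act1E /=.
  have /trivIsetP -> // : trivIset setT (D f) by exact: trivIset_seqDU.
    rewrite measure0 /= ltr_norml => /andP[].
    rewrite sub0r ltrN2 => le _; apply: le_trans (ltW le).
    apply: fine_probability_mono; try exact: measurableI.
    by apply: setISS; rewrite /G; case: ifP => _; by [exact: subIsetl|exact: sub0set].
  by rewrite (ltn_eqF jk).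
have := bonferroni (ltW eta0) mG G_disj.
have Dsum : 1 - eps <= \sum_(j < m) fine (mu (D f j)).
  apply: le_trans (fine_probability_bigsetU_le_sum mu m (mD f)).
  rewrite -bigsetU_seqDU -lee_fin fineK_probability; last exact: bigsetU_measurable.
  apply: le_trans (Acover f fF) _.
  by rewrite (big_nth [::]) big_mkcond big_mkord.
have : \sum_(j < m) fine (mu (D f j)) - (m * (1 + 2 * M))%:R * eta
    <= \sum_(j < m) fine (nu (G j)).
  apply: (@le_trans _ _ (\sum_(j < m) (fine (mu (D f j)) - (1 + 2 * M)%:R * eta))).
    rewrite sumrB lerD2l lerN2 sumr_const card_ord natrM.
    by rewrite -[leLHS]mulr_natl mulrA.
  by apply: ler_sum => j _; exact: G_large.
(* Of the allowed [2 * eps], one [eps] is already lost in [Acover]; the other pays for the transfer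
   and the overlaps. *)
have [] := K_le (m * (1 + 2 * M) + m ^ 2)%N ltac:(lia).
rewrite [in X in X -> _]natrD mulrDl => le1 _ le2 le3.
have mU : measurable (\big[setU/set0]_(j < m) G j) by exact: bigsetU_measurable.
have mgen : measurable [set y | gen b B0 (y, b f y)].
  by apply: measurable_section; exact: measurable_gen.
apply: (@le_trans _ _ (nu (\big[setU/set0]_(j < m) G j))); last first.
  apply: le_measure; rewrite ?inE// => y.
  rewrite -bigcup_mkord => -[j /= jm]; rewrite /G; case: eqP => // wf [_ yw].
  by exists (wrd j); rewrite //= wf.
by rewrite -(fineK_probability nu mU) lee_fin; lra.
Qed.

End graphing_transfer.

(** * Graphings of subrelations of a free action *)

Section free_action_graphings.
Context {Gamma : groupType} {R : realType} {d : measure_display}.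
Context {X : measurableType d} {mu : probability X R} (a : mp_action Gamma mu).
Hypothesis Gamma_countable : countable [set: Gamma].
Hypothesis X_standard : standard_borel R X.
Hypothesis a_free : free_action a.

(** Empty at the identity, which fixes every point, so that the union over all of [Gamma] is
    null. *)
Let fixed g : set X := if g == 1%g then set0 else [set x | a g x = x].

Let measurable_fixed g : measurable (fixed g).
Proof.
rewrite /fixed; case: eqP => // _; rewrite -[X in measurable X]setTI.
apply: (measurable_equalizer X_standard) => //; exact: measurable_act.
Qed.

Let measure_fixed g : mu (fixed g) = 0%E.
Proof.
by rewrite /fixed; case: eqP => [_|g1]; [exact: measure0|exact: a_free].
Qed.

Let nonfree : set X := \bigcup_g fixed g.

Let measurable_nonfree : measurable nonfree.
Proof. exact: countable_bigcupT_measurable. Qed.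

Let measure_nonfree : mu nonfree = 0%E.
Proof. exact: null_bigcup. Qed.

(** Otherwise [h^-1 * g] would be a nontrivial element fixing [x]. *)
Let act_inj x g h : ~ nonfree x -> a g x = a h x -> g = h.
Proof.
move=> xfree gh; have [//|/eqP nhg] := eqVneq g h; case: xfree.
exists (h^-1 * g)%g => //; rewrite /fixed; case: eqP => [hg1|_] /=.
  by case: nhg; rewrite -[RHS]mulg1 -hg1 mulgA mulgV mul1g.
by rewrite actM gh actK.
Qed.

Lemma sum_disjoint_le (T : choiceType) (S : seq T) (D : T -> set X) (B : set X) :
  uniq S -> (forall t, measurable (D t)) -> measurable B ->
  (forall t, D t `<=` B) -> (forall x s t, D s x -> D t x -> s = t) ->
  (\sum_(t <- S) mu (D t) <= mu B)%E.
Proof.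
move=> uS mD mB DB Dinj.
(* The bound by [mu B] alone is too weak for induction on [S]. *)
suff : (\sum_(t <- S) mu (D t) <= mu (B `&` \big[setU/set0]_(t <- S) D t))%E.
  move=> le; apply: le_trans le _; apply: measureIl => //.
  exact: bigsetU_measurable.
elim: S uS => [_|t S IHS /= /andP[tS uS]]; first by rewrite !big_nil setI0 measure0.
rewrite !big_cons; have mU : measurable (\big[setU/set0]_(t <- S) D t).
  exact: bigsetU_measurable.
rewrite setIUr measureU; [|exact: measurableI|exact: measurableI|].
  by rewrite (setIidr (DB t)) leeD2l// IHS.
rewrite -subset0 => x [[_ Dtx] [_]]; rewrite -bigcup_seq => -[s /= sS Dsx].
by move: tS; rewrite (Dinj _ _ _ Dtx Dsx) sS.
Qed.

(* The images of null sets under the maps of [Phi] are not known to be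
   measurable a priori.  But almost everywhere [pmap (Phi i)] is piecewise an
   element of [Gamma], so the image of the union of the pieces is measurable and
   its complement in [pcod (Phi i)] is null. *)
Lemma graphing_by_group (E : set (X * X)) (Phi : Lgraphing mu) :
  E `<=` orbit_rel a -> Lgraphing_of E Phi ->
  exists A : Gamma -> set X,
    [/\ forall g, measurable (A g),
      forall S, uniq S -> (\sum_(g <- S) mu (A g) <= Lcost Phi)%E &
      exists Z, [/\ measurable Z, mu (~` Z) = 0%E &
        forall x f, Z x -> E (x, a f x) ->
          exists2 w, path_set a A w x & word_elt w = f]].
Proof.
move=> Eorb [X0 [mX0 X0_conull PhiE]].
pose dom i := pdom (Phi i); pose cod i := pcod (Phi i).
pose phi i := Defs.pmap (Phi i).
have mdom i : measurable (dom i) by exact: measurable_pdom.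
have mcod i : measurable (cod i) by exact: measurable_pcod.
have mphi i : measurable_fun (dom i) (phi i) by exact: measurable_pmap.
have phi_pre i (B : set X) : measurable B -> measurable (dom i `&` phi i @^-1` B).
  by move=> mB; exact: mphi.
have phi_mu i (B : set X) : measurable B -> B `<=` cod i ->
    mu (dom i `&` phi i @^-1` B) = mu B by exact: measure_pmap.
have phi_cod i x : dom i x -> cod i (phi i x).
  by have [sub _ _] := pmap_bij (Phi i); exact: sub.
have phi_inj i x y : dom i x -> dom i y -> phi i x = phi i y -> x = y.
  by have [_ inj _] := pmap_bij (Phi i) => xi yi; apply: inj; rewrite inE.
pose D i g := (X0 `\` nonfree) `&` (dom i `&` phi i @^-1` X0) `&`
  (dom i `&` [set x | phi i x = a g x]).
have mD i g : measurable (D i g).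
  apply: measurableI; first by apply: measurableI; [exact: measurableD|exact: phi_pre].
  apply: (measurable_equalizer X_standard) => //.
  by apply: (@measurable_funS _ _ _ _ setT) => //; exact: measurable_act.
have mUD i : measurable (\bigcup_g D i g) by exact: countable_bigcupT_measurable.
have Ddom i g : D i g `<=` dom i by move=> x [_ []].
have mimD i : measurable (\bigcup_g (a g @` D i g)).
  by apply: countable_bigcupT_measurable => // g; exact: measurable_image_act.
pose A g := \bigcup_i D i g.
have mA g : measurable (A g) by exact: bigcupT_measurable.
exists A; split=> // [S uS|].
  apply: (@le_trans _ _ (\sum_(g <- S) \sum_(0 <= i <oo) mu (D i g))%E).
    by apply: lee_sum => g _; exact: measure_sigma_subadditive.
  rewrite -nneseries_sum//; apply: lee_nneseries => [i _ _|i _].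
    exact: sume_ge0.
  apply: (sum_disjoint_le uS (mD i) (mdom i) (Ddom i)).
  move=> x g h [[[_ xfree] _] [_ /= xg]] [_ [_ /= xh]].
  by apply: act_inj xfree _; rewrite -xg.
pose dom0 i := dom i `\` \bigcup_g D i g.
have dom0_null i : mu (dom0 i) = 0%E.
  (* Off [bad], both end points lie in [X0], so the edge belongs to [E] and hence to an orbit. The
     last part is null because [phi i] preserves [mu]. *)
  pose bad := (~` X0 `|` nonfree) `|` (dom i `&` phi i @^-1` (cod i `\` X0)).
  have mcodX0 : measurable (cod i `\` X0) by exact: measurableD.
  have mX0C : measurable (~` X0) by exact: measurableC.
  apply: (@subset_measure0 _ _ _ mu _ bad); first by apply: measurableD => //; exact: mdom.
  - by apply: measurableU; [exact: measurableU|exact: phi_pre].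
  - move=> x [ix nDx]; apply: contrapT => nbad; apply: nDx.
    have X0x : X0 x by apply: contrapT => nX0; apply: nbad; left; left.
    have xfree : ~ nonfree x by move=> xn; apply: nbad; left; right.
    have X0y : X0 (phi i x).
      apply: contrapT => nX0; apply: nbad; right; split=> //; split=> //.
      exact: phi_cod.
    have /Eorb[g /= xg] : E (x, phi i x).
      by apply/PhiE => // E' [_ subE']; apply: subE'; exists i.
    by exists g.
  - apply: null_set_setU => //; [exact: measurableU|exact: phi_pre| |].
      by apply: null_set_setU.
    apply: (etrans (phi_mu i _ mcodX0 _)); first by move=> x [].
    by apply: (@subset_measure0 _ _ _ mu _ (~` X0)) => // x [].
pose cod0 i := cod i `\` \bigcup_g (a g @` D i g).
have mcod0 i : measurable (cod0 i) by exact: measurableD.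
have cod0_null i : mu (cod0 i) = 0%E.
  rewrite -(phi_mu i _ (mcod0 i)); last by move=> x [].
  apply: (@subset_measure0 _ _ _ mu _ (dom0 i)) => //.
  - exact: phi_pre.
  - exact: measurableD.
  - move=> x [ix [_ nimx]]; split=> // -[g _ Dgx]; apply: nimx.
    by exists g => //; exists x => //; case: Dgx => _ [_ /= ->].
  - exact: dom0_null.
pose N := (~` X0 `|` nonfree) `|` (\bigcup_i dom0 i `|` \bigcup_i cod0 i).
have mdom0 i : measurable (dom0 i) by apply: measurableD => //; exact: mdom.
have mX0C : measurable (~` X0) by exact: measurableC.
have mN : measurable N.
  by apply: measurableU; apply: measurableU => //; exact: bigcupT_measurable.
have N_null : mu N = 0%E.
  apply: null_set_setU; try by apply: measurableU => //; exact: bigcupT_measurable.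
    exact: null_set_setU.
  by apply: null_set_setU; try exact: bigcupT_measurable; exact: null_bigcup.
(* The largest invariant set avoiding [N]; it is still conull because [Gamma] is countable. *)
pose Z := \bigcap_g a g @^-1` ~` N.
have Z_inv x g : Z x -> Z (a g x).
  by move=> Zx h _; have := Zx (h * g)%g I; rewrite /= actM.
have ZN x : Z x -> ~ N x by move=> /(_ 1%g I); rewrite /= act1.
have ZC : ~` Z = \bigcup_g a g @^-1` N.
  by rewrite /Z setC_bigcap; apply: eq_bigcupr => g _; rewrite preimage_setC setCK.
have mZC : measurable (~` Z).
  rewrite ZC; apply: countable_bigcupT_measurable => // g.
  exact: measurable_preimage_act.
exists Z; split.
- by rewrite -[Z]setCK; exact: measurableC.
- rewrite ZC; apply: null_bigcup => // g; first exact: measurable_preimage_act.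
  by rewrite measure_act.
have [Gr Gs Gt] := gen_equiv a A.
(* An equivalence relation that is [gen a A] on [Z] and identifies all points outside [Z].
   Minimality of the generated relation then reduces the claim to single edges of [Phi]. *)
pose E' := [set p : X * X | (Z p.1 <-> Z p.2) /\ (Z p.1 -> gen a A p)].
have gen_E' : generated_rel Phi `<=` E'.
  apply: smallest_sub.
    split=> [x|x y [/= xyZ xyG]|x y z [/= xyZ xyG] [/= yzZ yzG]].
    - by split.
    - by split=> [|/xyZ/xyG/Gs] //=; split=> /xyZ.
    - split=> /=; first by rewrite xyZ.
      by move=> Zx; apply: Gt (xyG Zx) _; apply/yzG/xyZ.
  move=> [x y] [i /= ix <-].
  have [[g [Dgx xZ]]|nDx] := pselect (exists g, D i g x /\ True).
    have xg : phi i x = a g x by case: Dgx => _ [].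
    rewrite /E' /= -/(phi i x) xg; split.
      split=> [|Zgx]; first exact: Z_inv.
      by rewrite -(actK a g x); exact: Z_inv.
    by move=> _; apply: gen_edge; exists i.
  (* An edge outside all pieces starts in [dom0 i] and, by injectivity of [phi i], ends in [cod0 i],
     so neither end lies in [Z]. *)
  have nZx : ~ Z x.
    move=> /ZN; apply; right; left; exists i => //; split=> // -[g _ Dgx].
    by apply: nDx; exists g.
  have nZy : ~ Z (phi i x).
    move=> /ZN; apply; right; right; exists i => //; split; first exact: phi_cod.
    move=> [g _ [u Dgu ux]]; apply: nDx; exists g; split=> //.
    have -> // : x = u; apply: phi_inj (Ddom _ _ _ Dgu) _ => //.
    by rewrite -ux; case: Dgu => _ [_ /= ->].
  by split.
have ZX0 x : Z x -> X0 x.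
  by move=> /ZN nNx; apply: contrapT => nX0; apply: nNx; left; left.
move=> x f Zx xf.
have /gen_E'[_ /(_ Zx)[w /= wx wf]] : generated_rel Phi (x, a f x).
  by apply/PhiE => //; [exact: ZX0|apply: ZX0; exact: Z_inv].
exists w => //; apply: act_inj wf => xn; apply: (ZN _ Zx); left; by right.
Qed.

End free_action_graphings.

(** * Choice of a stage of the exhaustion and of finitely many words, and conclusion *)

Lemma eventually_all (T : eqType) (F : seq T) (P : T -> nat -> Prop) :
  (forall f, f \in F -> exists N, forall n, (N <= n)%N -> P f n) ->
  exists N, forall f n, f \in F -> (N <= n)%N -> P f n.
Proof.
elim: F => [|f F IHF] FP; first by exists 0%N.
have [N1 N1P] := FP f (mem_head _ _).
have [N2 N2P] := IHF (fun g gF => FP g (mem_behead (s := f :: F) gF)).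
exists (maxn N1 N2) => g n; rewrite inE geq_max => /predU1P[->|gF] /andP[? ?].
  exact: N1P.
exact: N2P.
Qed.

Lemma increasing_measure_gt {R : realType} {d : measure_display}
    {X : measurableType d} (mu : probability X R) (V : nat -> set X) (c : \bar R) :
  (forall n, measurable (V n)) -> (forall n m, (n <= m)%N -> V n `<=` V m) ->
  (c < mu (\bigcup_n V n))%E ->
  exists N, forall n, (N <= n)%N -> (c < mu (V n))%E.
Proof.
move=> mV Vmono.
have muV n m : (n <= m)%N -> (mu (V n) <= mu (V m))%E.
  by move=> nm; apply: le_measure; rewrite ?inE//; exact: Vmono.
have cvg1 : mu (V n) @[n --> \oo] --> mu (\bigcup_n V n).
  apply: nondecreasing_cvg_mu => //; first exact: bigcupT_measurable.
  by move=> n m nm; rewrite subsetEset; exact: Vmono.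
have cvg2 := ereal_nondecreasing_cvgn muV.
have -> := cvg_unique (@ereal_hausdorff R) cvg1 cvg2.
move=> /ereal_sup_gt[_ [N _ <-] cN].
by exists N => n /muV; exact: lt_le_trans.
Qed.

(** The countably many words with value [f] cover almost all [x] with [E (x, a f x)]. The strict
    lower bound then survives, by continuity from below, for finitely many words. *)
Lemma finite_words_cover {Gamma : groupType} {R : realType}
    {d : measure_display} {X : measurableType d} {mu : probability X R}
    (a : mp_action Gamma mu) (A : Gamma -> set X) (E : set (X * X)) (Z : set X)
    (F : seq Gamma) (eps : R) :
  countable [set: Gamma] -> (forall g, measurable (A g)) -> measurable E ->
  measurable Z -> mu (~` Z) = 0%E ->
  (forall x f, Z x -> E (x, a f x) ->
    exists2 w, path_set a A w x & word_elt w = f) ->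
  (forall f, f \in F -> ((1 - eps)%:E < mu [set x | E (x, a f x)])%E) ->
  exists W, forall f, f \in F -> ((1 - eps)%:E <=
    mu (\big[setU/set0]_(w <- W | word_elt w == f) path_set a A w))%E.
Proof.
move=> cG mA mE mZ Z_conull EA FE.
have [e eP] := countable_enum [::] (countable_words cG).
pose V f n := \bigcup_(j < n)
  (if word_elt (e j) == f then path_set a A (e j) else set0).
have mVj f j : measurable (if word_elt (e j) == f then path_set a A (e j) else set0).
  by case: ifP => // _; exact: measurable_path_set.
have mV f n : measurable (V f n) by exact: bigcup_measurable.
have [|N NP] := @eventually_all Gamma F (fun f n => ((1 - eps)%:E < mu (V f n))%E).
  move=> f fF; apply: increasing_measure_gt => //.
    by move=> n m nm x [j /= jn Vx]; exists j => //=; exact: leq_trans nm.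
  apply: lt_le_trans (FE f fF) _.
  have mU : measurable (\bigcup_n V f n) by exact: bigcupT_measurable.
  rewrite -(measureU0 mU (measurableC mZ) Z_conull).
  apply: le_measure; rewrite ?inE//; first exact: measurable_section.
    by apply: measurableU => //; exact: measurableC.
  move=> x xf; have [Zx|] := pselect (Z x); last by right.
  left; have [w wx wf] := EA x f Zx xf; have [j ej] := eP w.
  by exists j.+1 => //; exists j => //=; rewrite ej wf eqxx.
exists [seq e j | j <- iota 0 N] => f fF.
apply: le_trans (ltW (NP f N fF (leqnn _))) _.
rewrite big_map big_mkcond /= -[N in iota 0 N]subn0 -/(index_iota 0 N) big_mkord.
by rewrite /V bigcup_mkord.
Qed.

(** All late stages of the exhaustion relate [x] to [a f x] for most [x], and a lower limit below
    [r] provides arbitrarily late stages of cost below [r]. The graphing of one such stage is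
    transferred to [b]. *)
Lemma approx_cost_le_of_weak_containment {Gamma : groupType} {R : realType}
    {d1 d2 : measure_display} {X : measurableType d1} {Y : measurableType d2}
    {mu : probability X R} {nu : probability Y R}
    (a : mp_action Gamma mu) (b : mp_action Gamma nu)
    (En : nat -> set (X * X)) (r : R) :
  countable [set: Gamma] -> standard_borel R X -> standard_borel R Y ->
  free_action a -> weakly_contained a b -> exhaustion (orbit_rel a) En ->
  (limn_einf (fun n => cost mu (En n)) < r%:E)%E -> approx_cost_le b r.
Proof.
move=> cG sX sY a_free ab [mEn Esub EU] r_gt F eps eps0.
have Emono n m : (n <= m)%N -> En n `<=` En m.
  move=> /subnK <-; elim: (m - n)%N => [//|k IHk].
  by apply: subset_trans IHk _; exact: Esub.
(* Halved because the transfer doubles the error. *)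
pose e := (eps / 2)%R; have e0 : (0 < e)%R by rewrite divr_gt0.
have [|N NP] := @eventually_all Gamma F
    (fun f n => ((1 - e)%:E < mu [set x | En n (x, a f x)])%E).
  move=> f fF; apply: increasing_measure_gt.
  - by move=> n; apply: measurable_section; case: (mEn n).
  - by move=> n m nm x; exact: Emono.
  - rewrite [X in mu X](_ : _ = setT); last first.
      apply/seteqP; split=> // x _.
      have : orbit_rel a (x, a f x) by exists f.
      by rewrite -EU => -[n _ nx]; exists n.
    by rewrite probability_setT lte_fin ltrBlDr ltrDl.
(* The lower limit is the supremum of the tail infima, so the tail from [N] on also has infimum
   below [r]. *)
have : (einfs (fun n => cost mu (En n)) N < r%:E)%E.
  apply: le_lt_trans r_gt; rewrite limn_einf_lim.
  rewrite (cvg_lim (@ereal_hausdorff R) (@cvg_einfs_sup R _)).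
  by apply: ereal_sup_ubound; exists N.
move=> /ereal_inf_lt[_ [n /= Nn <-]] /ereal_inf_lt[_ [Phi PhiE <-] Phir].
have Lcost_ge0 : (0 <= Lcost Phi)%E by exact: nneseries_ge0.
have Lcost_fin : Lcost Phi \is a fin_num by rewrite ge0_fin_numE// (lt_trans Phir)// ltry.
have Eorb : En n `<=` orbit_rel a by rewrite -EU; exact: bigcup_sup.
have [A [mA Acost [Z [mZ Z_conull ZA]]]] :=
  graphing_by_group cG sX a_free Eorb PhiE.
have [W WP] := finite_words_cover cG mA (mEn n).1 mZ Z_conull ZA
  (fun f fF => NP f n fF Nn).
pose S := undup [seq l.1 | l <- flatten W].
have WS w : w \in W -> {subset [seq l.1 | l <- w] <= S}.
  move=> wW g /mapP[l lw ->]; rewrite mem_undup; apply: map_f.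
  by apply/flattenP; exists w.
have Sc : (\sum_(g <- S) mu (A g) <= (fine (Lcost Phi))%:E)%E.
  by rewrite fineK//; apply: Acost; exact: undup_uniq.
have cr : (fine (Lcost Phi) < r)%R by rewrite -lte_fin fineK.
have [SB SBr SBP] :=
  finite_graphing_transfer cG sY ab (undup_uniq _) mA WS Sc cr e0 WP.
exists SB => // f fF; have := SBP f fF.
by rewrite [(2 * e)%R]mulrC divfK// pnatr_eq0.
Qed.

Theorem theorem1p5 (R : realType) (Gamma : groupType)
    (Gamma_countable : countable [set: Gamma])
    (d1 d2 : measure_display) (X : measurableType d1) (Y : measurableType d2)
    (X_standard : standard_borel R X) (Y_standard : standard_borel R Y)
    (mu : probability X R) (nu : probability Y R)
    (a : mp_action Gamma mu) (b : mp_action Gamma nu)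
    (a_free : free_action a) (a_prec_b : weakly_contained a b) :
  (PC b <= PC a)%E.
Proof.
apply: le_ereal_inf_tmp => _ [En En_exh <-].
(* The approximation property has a real cost bound, so the lower limit is approached through the
   reals above it. *)
have PC_le r : (limn_einf (fun n => cost mu (En n)) < r%:E)%E -> (PC b <= r%:E)%E.
  move=> lt_r; apply: PC_le_of_approx => //.
  exact: (@approx_cost_le_of_weak_containment _ _ _ _ _ _ _ _ a b En).
case E : (limn_einf _) PC_le => [l||] PC_le.
- by apply/lee_addgt0Pr => e e0; apply: PC_le; rewrite lte_fin ltrDl.
- exact: leey.
- by rewrite (@eq_ninfty _ (PC b))// => r; apply: PC_le; exact: ltNyr.
Qed.
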